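(* Let $\alpha,\gamma,\mu>0$. In the two-customer game with index costs, no closing time, and arrivals allowed at any $t\in\mathbb{R}$, the following density defines a unique symmetric equilibrium arrival distribution: $$f(t)=\begin{cases}\dfrac{\alpha}{\gamma+\frac{\alpha}{\mu}}, & t\in\left[-\frac{\gamma}{\alpha},0\right],\\[3mm] \dfrac{\mu}{\left(1+\frac{\alpha}{\gamma\mu}\right)\left(1+\frac{\gamma\mu}{\alpha}\right)}\,e^{-\frac{\mu}{1+\frac{\alpha}{\gamma\mu}}t}, & t\in(0,\infty),\\[3mm] 0,&\text{otherwise.}\end{cases}$$ The expected cost for each customer in this equilibrium is $c_e=\gamma$.
   Context: Model. There are two customers, each choosing (possibly at random, independently) an arrival time. A single server starts operating at time $0$ and serves First Come First Served; service times are i.i.d. exponential with rate $\mu$. Customers arriving at exactly the same time are admitted in uniformly random order. Each customer pays $\alpha$ per unit of time from arrival until admission into service, and $\gamma$ if the other customer is ahead of him in the arrival order. When the other customer arrives according to a cdf $F$, the expected cost of arriving at $t$ is $$c_F(t)=-\alpha t\,\mathbf{1}_{\{t<0\}}+\frac{\alpha}{\mu}\mathbb{E}Q_F(t)+\gamma\,\mathbb{E}A_F(t),$$ where $A_F(t)\in\{0,1\}$ indicates whether the other customer has arrived up to time $t$ and $Q_F(t)\in\{0,1\}$ whether he is present in the system at time $t$; if $F$ has an atom at $t$, a simultaneous arrival counts only if placed ahead by the random tie-breaking. A symmetric equilibrium arrival distribution is a cdf $F$ for which there is a constant $c_e$ (the equilibrium cost) such that $c_F(t)=c_e$ for all $t$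 in the support of $F$ and $c_F(t)\ge c_e$ for every admissible $t$. Only distributions $F$ whose support is, on any finite interval, a finite union of closed intervals and points are considered. *)

(* Defs.v *)
From HB Require Import structures.
From mathcomp Require Import all_boot all_order all_algebra.
From mathcomp Require Import all_classical all_reals all_analysis.

Set Implicit Arguments.
Unset Strict Implicit.
Unset Printing Implicit Defensive.
Import Order.TTheory GRing.Theory Num.Theory.
Import numFieldNormedType.Exports.

Local Open Scope classical_set_scope.
Local Open Scope ring_scope.

Section TwoCustomerGame.
Context {R : realType}.

(* A cdf on the real line: nondecreasing, right-continuous, with limits 0 and 1
   at -oo and +oo. *)
Definition real_cdf := cumulativeBounded (0 : R) (1 : R).

Definition arrival_law (F : real_cdf) : probability (measurableTypeR R) R :=
  lebesgue_stieltjes_measure F.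

(* The library's probability structure on [exponential_prob mu] needs [0 < mu];
   the goal left by [refine] is exactly that side condition. *)
Definition service_law (mu : R) (mu_gt0 : 0 < mu) :
  probability (measurableTypeR R) R.
Proof.
refine (exponential_prob mu : probability (measurableTypeR R) R).
exact: mu_gt0.
Defined.

Definition coin_law : probability bool R := bernoulli_prob (2^-1 : R).

(* A sample point is ((a, s), b): [a] is the arrival time of the other customer,
   [s] his service time, and [b] the outcome of the fair tie-breaking coin
   ([true] places him ahead in case of a simultaneous arrival); the three are
   independent. *)
Definition sample := ((measurableTypeR R * measurableTypeR R) * bool)%type.

Definition sample_law (mu : R) (mu_gt0 : 0 < mu) (F : real_cdf) :
    probability sample R :=
  ((arrival_law F \x service_law mu_gt0) \x coin_law)%E.

Definition other_ahead (t : R) (w : sample) : bool :=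
  let: ((a, _), b) := w in (a < t) || ((a == t) && b).

(* When the other customer is ahead, nobody delays him: his service starts at
   [Num.max a 0] (the server opens at 0) and he leaves at
   [Num.max a 0 + s]. *)
Definition other_present (t : R) (w : sample) : bool :=
  let: ((a, s), _) := w in other_ahead t w && (t < Num.max a 0 + s).

Definition A_ (t : R) (w : sample) : R := (other_ahead t w)%:R.
Definition Q_ (t : R) (w : sample) : R := (other_present t w)%:R.

Definition cost (alpha gamma mu : R) (mu_gt0 : 0 < mu) (F : real_cdf) (t : R) :
    \bar R :=
  ((- alpha * t * (t < 0)%R%:R)%:E
   + (alpha / mu)%:E * 'E_(sample_law mu_gt0 F)[Q_ t]
   + gamma%:E * 'E_(sample_law mu_gt0 F)[A_ t])%E.

Definition support (F : real_cdf) : set R :=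
  [set t | forall U : set R, open U -> U t -> (0 < arrival_law F U)%E].

(* Points are the degenerate intervals [l, l]. *)
Definition locally_finite_union_of_intervals (S : set R) : Prop :=
  forall a b : R, exists s : seq (R * R),
    S `&` `[a, b] = [set t | exists2 I, I \in s & t \in `[I.1, I.2]].

Definition equilibrium_cost (alpha gamma mu : R) (mu_gt0 : 0 < mu)
    (F : real_cdf) (c : R) : Prop :=
  (forall t, support F t -> cost alpha gamma mu_gt0 F t = c%:E) /\
  (forall t, (c%:E <= cost alpha gamma mu_gt0 F t)%E).

Definition symmetric_equilibrium (alpha gamma mu : R) (mu_gt0 : 0 < mu)
    (F : real_cdf) : Prop :=
  locally_finite_union_of_intervals (support F) /\
  exists c, equilibrium_cost alpha gamma mu_gt0 F c.

Definition has_density (F : real_cdf) (f : R -> R) : Prop :=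
  [/\ measurable_fun setT f, (forall t, 0 <= f t) &
      forall t, (F t)%:E = (\int[lebesgue_measure]_(x in `]-oo, t]) (f x)%:E)%E].

Definition equilibrium_density (alpha gamma mu : R) (t : R) : R :=
  if - (gamma / alpha) <= t <= 0 then alpha / (gamma + alpha / mu)
  else if 0 < t then
    mu / ((1 + alpha / (gamma * mu)) * (1 + gamma * mu / alpha))
    * expR (- (mu / (1 + alpha / (gamma * mu))) * t)
  else 0.

End TwoCustomerGame.

Arguments real_cdf R : clear implicits.
Arguments sample R : clear implicits.

(* Main.v *)
(* For a cdf F let I(t) be the probability that the other customer has left by
   time t. With independent exponential service the cost is
     alpha t^- + (gamma + alpha / mu) M(t) - (alpha / mu) I(t),
   M being the average of F and its left limit. The lack of memory gives
     e I(r) + (1 - e) F(r) <= I(t) <= e I(r) + (1 - e) F(t)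
   for 0 <= r <= t and e = exp(-mu (t - r)): I is Lipschitz, and I' = mu (F - I)
   where F is Lipschitz.
   In an equilibrium F has no atom (arriving just before it would be cheaper) and
   no gap after its first support point (the cost decreases along a gap), so the
   cost is constant wherever F > 0. Letting t tend to +oo, the constant is gamma.
   For t <= 0 this gives F directly; for t >= 0 it turns I' = mu (F - I) into a
   linear equation for I with I(0) = 0. The same equation, run backwards, shows
   that the cdf so obtained is an equilibrium. *)

Require Import Defs.
From HB Require Import structures.
From mathcomp Require Import all_boot all_order all_algebra.
From mathcomp Require Import all_classical all_reals all_analysis.
From mathcomp Require Import measurable_realfun ring lra.

Import Order.TTheory GRing.Theory Num.Theory.
Import numFieldNormedType.Exports.

Local Open Scope classical_set_scope.
Local Open Scope ring_scope.

Lemma expR_decay_le1 {R : realType} (k x : R) :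
  0 <= k -> 0 <= x -> expR (- k * x) <= 1.
Proof. by move=> k0 x0; rewrite -expR0 ler_expR mulNr oppr_le0 mulr_ge0. Qed.

(** * The expected cost *)

Section ExpectedCost.
Context {R : realType} {mu : R} (mu_gt0 : 0 < mu) (F : real_cdf R).

(** The truncation gives the value 0 when the service has not begun, so the integrals over [a] below
    need no restriction to [a <= t]. *)
Definition service_cdf (k x : R) : R := 1 - expR (- k * Num.max x 0).

Lemma service_law_itvNyo0 : service_law mu_gt0 `]-oo, 0[%classic = 0%E.
Proof.
apply: integral0_eq => x /=; rewrite in_itv/= => x0.
by rewrite lt0_exponential_pdf.
Qed.

Lemma service_law_le (x : R) :
  service_law mu_gt0 [set s | s <= x] = (service_cdf mu x)%:E.
Proof.
rewrite /service_cdf; have [x0|x0] := ltP x 0.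
  rewrite mulr0 expR0 subrr; apply/eqP; rewrite eq_le measure_ge0 andbT.
  rewrite -[leRHS]/0%E -[leRHS]service_law_itvNyo0.
  apply: le_measure; rewrite ?inE.
  - by rewrite -set_itvNyc; exact: measurable_itv.
  - exact: measurable_itv.
  - by move=> s /= sx; rewrite in_itv/= (le_lt_trans sx).
have -> : [set s | s <= x] = `]-oo, 0[%classic `|` `[0, x]%classic.
  apply/seteqP; split => [s /= sx|s [|] /=]; rewrite ?in_itv/=.
  - by have [s0|s0] := ltP s 0; [left|right]; rewrite ?s0.
  - by move/ltW/le_trans; apply.
  - by case/andP.
rewrite measureU/=; [|exact: measurable_itv|exact: measurable_itv|]; last first.
  apply/seteqP; split => // s [] /=; rewrite !in_itv/= => s0 /andP[].
  by rewrite leNgt s0.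
rewrite [X in (X + _)%E]service_law_itvNyo0 add0e.
move: x0; rewrite le_eqVlt => /predU1P[<-|x0].
  by rewrite mulr0 expR0 subrr set_itv1 [LHS]integral_set1.
by rewrite [LHS]exponential_prob_itv0c// EFinB.
Qed.

Lemma arrival_law_le (t : R) : arrival_law F [set a | a <= t] = (F t)%:E.
Proof.
rewrite -cdf_lebesgue_stieltjes_id /cdf /distribution /pushforward.
by rewrite preimage_id set_itvNyc.
Qed.

(** Encoding the left limit of [F] as the mass of an open half-line lets monotonicity of the measure
    replace limit arguments. *)
Definition left_lim (t : R) : R := fine (arrival_law F [set a | a < t]).

(** The probability that the other customer is ahead: an atom at [t] counts for half, because of the
    fair coin. *)
Definition mid_cdf (t : R) : R := (left_lim t + F t) / 2.

Lemma arrival_law_lt (t : R) : arrival_law F [set a | a < t] = (left_lim t)%:E.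
Proof.
by rewrite /left_lim fineK// fin_num_measure// -set_itvNyo; exact: measurable_itv.
Qed.

Lemma coin_law1 (b : bool) : @coin_law R [set b] = (2^-1)%:E.
Proof.
rewrite [LHS]bernoulli_probE; last by lra.
rewrite !diracE !in_set1; case: b => /=.
  by rewrite mule1 mule0 adde0.
by rewrite mule1 mule0 add0e /unstable.onem; congr EFin; lra.
Qed.

(* [departure_cdf t] is the probability that [Num.max a 0 + s <= t], the inner
   integral over the service time [s] being carried out. *)
Definition departure_cdf (t : R) : R :=
  fine (\int[arrival_law F]_a (service_cdf mu (t - Num.max a 0))%:E).

Lemma service_cdf_ge0 k (x : R) : 0 <= k -> 0 <= service_cdf k x.
Proof.
by move=> k0; rewrite subr_ge0 expR_decay_le1// le_max lexx orbT.
Qed.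

Lemma service_cdf_le1 k (x : R) : service_cdf k x <= 1.
Proof. by rewrite lerBlDr lerDl expR_ge0. Qed.

Lemma measurable_service_cdf k (t : R) :
  measurable_fun setT
    (fun a : measurableTypeR R => service_cdf k (t - Num.max a 0)).
Proof.
apply: measurable_funB => //; apply: measurableT_comp => //.
apply: measurable_funM => //.
apply: measurable_funrpos.
apply: measurable_funB => //; exact: measurable_funrpos.
Qed.

Lemma integral_service_cdf (t : R) :
  (\int[arrival_law F]_a (service_cdf mu (t - Num.max a 0))%:E)%E =
  (departure_cdf t)%:E.
Proof.
rewrite /departure_cdf fineK//; apply/fin_numPlt/andP; split.
  apply: (@lt_le_trans _ _ 0%E) => //; apply: integral_ge0 => a _.
  by rewrite lee_fin service_cdf_ge0// ltW.
apply: (@le_lt_trans _ _ (\int[arrival_law F]_a 1)%E); last first.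
  by rewrite integral_cst// mul1e [ltLHS]probability_setT ltry.
apply: ge0_le_integral => //.
- by move=> a _; rewrite lee_fin service_cdf_ge0// ltW.
- by apply/measurable_EFinP; exact: measurable_service_cdf.
- by move=> a _; rewrite lee_fin service_cdf_le1.
Qed.

Let arrival_service : set (measurableTypeR R * measurableTypeR R) -> \bar R :=
  (arrival_law F \x service_law mu_gt0)%E.

Definition ahead (t : R) (b : bool) (a : R) : bool := (a < t) || ((a == t) && b).

Lemma aheadE t b : ahead t b = if b then (fun a => a <= t) else (fun a => a < t).
Proof.
apply/funext => a; rewrite /ahead; case: b; last by rewrite andbF orbF.
by rewrite andbT le_eqVlt orbC.
Qed.

Lemma measurable_ahead t b : measurable [set a : measurableTypeR R | ahead t b a].
Proof.
rewrite aheadE; case: b; [rewrite -set_itvNyc|rewrite -set_itvNyo];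
  exact: measurable_itv.
Qed.

Lemma arrival_law_ahead t b :
  arrival_law F [set a | ahead t b a] = (if b then F t else left_lim t)%:E.
Proof.
rewrite aheadE; case: b; [exact: arrival_law_le|exact: arrival_law_lt].
Qed.

Lemma measurable_present t :
  measurable [set x : measurableTypeR R * measurableTypeR R |
    t < Num.max x.1 0 + x.2].
Proof.
have mf : measurable_fun setT
    (fun x : measurableTypeR R * measurableTypeR R => Num.max x.1 0 + x.2 : R).
  apply: measurable_funD; last exact: measurable_snd.
  by apply: measurable_funrpos; exact: measurable_fst.
have := mf measurableT _ (measurable_itv `]t, +oo[).
rewrite setTI; congr measurable; apply/seteqP; split => x /=;
  by rewrite in_itv/= andbT.
Qed.

Definition ahead_present t b : set (measurableTypeR R * measurableTypeR R) :=
  [set x | ahead t b x.1 && (t < Num.max x.1 0 + x.2)].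

Lemma measurable_ahead_present t b : measurable (ahead_present t b).
Proof.
rewrite (_ : ahead_present t b = ([set a | ahead t b a] `*` setT) `&`
    [set x | t < Num.max x.1 0 + x.2]); last first.
  apply/seteqP; split => x; rewrite /ahead_present/=; first by case/andP.
  by move=> [[-> _] ->].
apply: measurableI; last exact: measurable_present.
by apply: measurableX => //; exact: measurable_ahead.
Qed.

(** A customer who has left by [t] was ahead, almost surely and for either outcome of the coin.
    Hence being present has the probability of being ahead minus that of having left. *)
Lemma arrival_service_ahead_present t b :
  arrival_service (ahead_present t b) =
  ((if b then F t else left_lim t) - departure_cdf t)%:E.
Proof.
(* In additive form both terms are integrals of nonnegative functions of [a], and the identity can
   be checked fibre by fibre. *)
have H : (arrival_service (ahead_present t b) + (departure_cdf t)%:E =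
          (if b then F t else left_lim t)%:E)%E.
  rewrite -integral_service_cdf /arrival_service /product_measure1.
  rewrite -ge0_integralD//; first last.
  - by apply/measurable_EFinP; exact: measurable_service_cdf.
  - by move=> a _; rewrite lee_fin service_cdf_ge0// ltW.
  - apply: measurable_fun_xsection; exact: measurable_ahead_present.
  rewrite -arrival_law_ahead -[in RHS](setIT [set a | _]).
  rewrite -integral_indic//; last exact: measurable_ahead.
  apply: eq_integral => a _; rewrite indicE.
  rewrite -[X in (X + _)%E]/(service_law mu_gt0 (xsection (ahead_present t b) a)).
  have [aht|naht] := boolP (ahead t b a).
    rewrite (_ : xsection _ _ = ~` [set s | s <= t - Num.max a 0]); last first.
      apply/seteqP; split => s; rewrite /xsection/= inE /ahead_present/= aht/=.
        by rewrite -ltrBlDl => /lt_geF ->.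
      by move=> /negP; rewrite -ltNge ltrBlDl.
    rewrite probability_setC; last by rewrite -set_itvNyc; exact: measurable_itv.
    by rewrite service_law_le -EFinB -EFinD subrK mem_set.
  rewrite (_ : xsection _ _ = set0); last first.
    apply/seteqP; split => // s; rewrite /xsection/= inE /ahead_present/= => /andP[h].
    by rewrite h in naht.
  rewrite measure0 add0e memNset; last exact/negP.
  (* Not being ahead forces [t <= a]. A tie lost by the coin gives the argument 0, where
     [service_cdf] still vanishes. *)
  rewrite /service_cdf (_ : Num.max (t - Num.max a 0) 0 = 0).
    by rewrite mulr0 expR0 subrr.
  apply/max_idPr; rewrite subr_le0 le_max.
  by move: naht; rewrite negb_or -leNgt => /andP[-> _].
by rewrite EFinB -H addeK.
Qed.

Lemma measurable_coin_split (B : bool -> set (measurableTypeR R * measurableTypeR R)) :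
  (forall b, measurable (B b)) -> measurable [set w : sample R | B w.2 w.1].
Proof.
move=> mB; rewrite (_ : [set w | _] =
  (B true `*` [set true]) `|` (B false `*` [set false])); last first.
  apply/seteqP; split => [[x []] /= Bx|[x b] [] [/= Bx ->]//]; [left|right];
  by [].
by apply: measurableU; exact: measurableX.
Qed.

(** Conditioning on the coin reduces everything to the joint law of arrival and service time. *)
Lemma sample_law_coin_split
    (B : bool -> set (measurableTypeR R * measurableTypeR R)) :
  (forall b, measurable (B b)) ->
  sample_law mu_gt0 F [set w | B w.2 w.1] =
  ((2^-1)%:E * arrival_service (B true) +
   (2^-1)%:E * arrival_service (B false))%E.
Proof.
move=> mB; rewrite (_ : [set w | _] =
  (B true `*` [set true]) `|` (B false `*` [set false])); last first.
  apply/seteqP; split => [[x []] /= Bx|[x b] [] [/= Bx ->]//]; [left|right];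
  by [].
rewrite measureU; [|exact: measurableX|exact: measurableX|]; last first.
  by apply/seteqP; split => // -[x b] [[_ /= ->] []].
have E b : sample_law mu_gt0 F (B b `*` [set b]) =
    ((2^-1)%:E * arrival_service (B b))%E.
  rewrite [LHS]product_measure1E// muleC; congr (_ * _)%E; exact: coin_law1.
by congr (_ + _)%E; exact: E.
Qed.

Lemma expectation_A (t : R) :
  ('E_(sample_law mu_gt0 F)[A_ t] = (mid_cdf t)%:E)%E.
Proof.
pose B b : set (measurableTypeR R * measurableTypeR R) :=
  [set a | ahead t b a] `*` setT.
have mB b : measurable (B b).
  by apply: measurableX => //; exact: measurable_ahead.
have -> : A_ t = \1_[set w : sample R | B w.2 w.1].
  apply/funext => -[[a s] b]; rewrite indicE /A_; congr (_ %:R); congr nat_of_bool.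
  by apply/idP/idP; rewrite inE; [move=> h; split|case].
rewrite expectation_indic; last exact: measurable_coin_split.
rewrite sample_law_coin_split//.
have E b : arrival_service (B b) = (if b then F t else left_lim t)%:E.
  rewrite [LHS]product_measure1E//; last exact: measurable_ahead.
  rewrite [X in (_ * X)%E]probability_setT mule1; exact: arrival_law_ahead.
by rewrite !E -!EFinM -EFinD /mid_cdf; congr EFin; field.
Qed.

Lemma expectation_Q (t : R) :
  ('E_(sample_law mu_gt0 F)[Q_ t] = (mid_cdf t - departure_cdf t)%:E)%E.
Proof.
have -> : Q_ t = \1_[set w : sample R | ahead_present t w.2 w.1].
  apply/funext => -[[a s] b]; rewrite indicE /Q_; congr (_ %:R); congr nat_of_bool.
  by apply/idP/idP; rewrite inE.
rewrite expectation_indic; last first.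
  by apply: measurable_coin_split; exact: measurable_ahead_present.
rewrite sample_law_coin_split; last exact: measurable_ahead_present.
rewrite !arrival_service_ahead_present -!EFinM -EFinD /mid_cdf.
by congr EFin; field.
Qed.

(** Separates the only term that can jump, [mid_cdf], from two Lipschitz terms; all equilibrium
    arguments use this form. *)
Lemma costE alpha gamma (t : R) :
  cost alpha gamma mu_gt0 F t =
  (alpha * Num.max (- t) 0 + (gamma + alpha / mu) * mid_cdf t
   - alpha / mu * departure_cdf t)%:E.
Proof.
rewrite /cost expectation_A expectation_Q -!EFinM -!EFinD; congr EFin.
have [t0|t0] := ltP t 0.
  by rewrite (max_idPl _) ?oppr_ge0 ?ltW//=; ring.
by rewrite (max_idPr _) ?oppr_le0//=; ring.
Qed.

End ExpectedCost.

Arguments left_lim {R} F t.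
Arguments mid_cdf {R} F t.
Arguments departure_cdf {R} mu F t.

(** * Support and left limits of a cdf *)

Section Cdf.
Context {R : realType} (F : real_cdf R).

Lemma real_cdf_nd (s t : R) : s <= t -> F s <= F t.
Proof. exact: cumulative_is_nondecreasing. Qed.

Lemma real_cdf_ge0 (t : R) : 0 <= F t.
Proof. by rewrite -lee_fin -arrival_law_le measure_ge0. Qed.

Lemma real_cdf_le1 (t : R) : F t <= 1.
Proof.
rewrite -lee_fin -arrival_law_le probability_le1// -set_itvNyc.
exact: measurable_itv.
Qed.

Lemma left_lim_le (t : R) : left_lim F t <= F t.
Proof.
rewrite -lee_fin -arrival_law_le -arrival_law_lt; apply: le_measure.
- by rewrite inE -set_itvNyo; exact: measurable_itv.
- by rewrite inE -set_itvNyc; exact: measurable_itv.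
- by move=> a /ltW.
Qed.

Lemma left_lim_ge (s t : R) : s < t -> F s <= left_lim F t.
Proof.
move=> st; rewrite -lee_fin -arrival_law_le -arrival_law_lt; apply: le_measure.
- by rewrite inE -set_itvNyc; exact: measurable_itv.
- by rewrite inE -set_itvNyo; exact: measurable_itv.
- by move=> a /= /le_lt_trans; apply.
Qed.

Lemma mid_cdf_le (t : R) : mid_cdf F t <= F t.
Proof. by have := left_lim_le t; rewrite /mid_cdf; lra. Qed.

Lemma mid_cdf_ge (t : R) : left_lim F t <= mid_cdf F t.
Proof. by have := left_lim_le t; rewrite /mid_cdf; lra. Qed.

Lemma mid_cdf_ge0 (t : R) : 0 <= mid_cdf F t.
Proof.
apply: le_trans (mid_cdf_ge t); apply: le_trans (real_cdf_ge0 (t - 1)) _.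
by apply: left_lim_ge; lra.
Qed.

Lemma arrival_law_itvoc (u v : R) : u <= v ->
  arrival_law F `]u, v]%classic = (F v - F u)%:E.
Proof.
move=> uv; rewrite /arrival_law/= /lebesgue_stieltjes_measure /measure_extension.
by rewrite measurable_mu_extE/= ?wlength_itv_bnd//; exact: is_ocitv.
Qed.

(** Trades open sets for increments of [F]: an open interval lies in the half-open one with the same
    ends, and a neighbourhood of [t] contains a half-open interval around it. *)
Lemma support_cdfP (t : R) :
  Defs.support F t <-> forall u v : R, u < t -> t < v -> F u < F v.
Proof.
split=> [sF u v ut tv|Flt U oU Ut].
  have uv : u < v := lt_trans ut tv.
  have := sF `]u, v[%classic _.
  rewrite -subr_gt0 -lte_fin -arrival_law_itvoc ?(ltW uv)// /= in_itv/= ut tv.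
  move=> /(_ _ isT)/lt_le_trans; apply => //.
  apply: le_measure; rewrite ?inE; try exact: measurable_itv.
  by apply: subset_itvl; rewrite bnd_simp.
have /nbhs_ballP[e /= e0 tU] : nbhs t U by exact: open_nbhs_nbhs.
(* Half the radius keeps the closed right end inside the ball. *)
apply: (@lt_le_trans _ _ (arrival_law F `]t - e / 2, t + e / 2]%classic)).
  by rewrite arrival_law_itvoc ?lte_fin ?subr_gt0 ?Flt//; lra.
apply: le_measure; rewrite ?inE.
- exact: measurable_itv.
- exact: open_measurable.
- move=> x /=; rewrite in_itv/= => /andP[xl xr].
  by apply: tU; rewrite /ball/= ltr_norml; lra.
Qed.

Lemma real_cdf_gt (e : R) : 0 < e -> exists T : R, forall t, T < t -> 1 - e < F t.
Proof.
move=> e0.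
have [T [_ HT]] : \forall t \near +oo, 1 - e < F t.
  by apply: (cvgr_gt (1 : R)); [exact: cumulativey|rewrite ltrBlDr ltrDl].
by exists T.
Qed.

Lemma real_cdf_lt (e : R) : 0 < e -> exists t : R, F t < e.
Proof.
move=> e0.
have [T [_ HT]] : \forall t \near -oo, F t < e.
  by apply: (cvgr_lt (0 : R)); [exact: cumulativeNy|].
by exists (T - 1); apply: HT; rewrite ltrBlDr ltrDl.
Qed.

(* The witness is the infimum of the level set [F >= F x]. *)
Lemma support_level (x : R) : 0 < F x ->
  exists b : R, [/\ b <= x, Defs.support F b & F b = F x].
Proof.
move=> Fx0; pose A := [set y | F x <= F y].
have Ax : A x by exact: lexx.
have [l Fl] := real_cdf_lt _ Fx0.
have lA : lbound A l.
  move=> y; rewrite /A/= => Ay.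
  by rewrite leNgt; apply/negP => /ltW/real_cdf_nd Fyl; lra.
have hA : has_inf A by split; [exists x|exists l].
pose b := inf A.
have bx : b <= x by apply: ge_inf => //; exists l.
(* Right continuity carries the inequality from points of [A] close to the infimum to [b] itself. *)
have Fbx : F b = F x.
  apply/le_anti; rewrite real_cdf_nd//=; apply/ler_addgt0Pr => e e0.
  have [d Fd] := @nondecreasing_right_continuousP _ b _ F e0.
  have [y Ay yb] := inf_adherent [gt0 of d%:num] hA.
  by apply: le_trans Ay _; apply: le_trans Fd; apply: real_cdf_nd; exact: ltW.
exists b; split => //; apply/support_cdfP => u v ub bv.
apply: (@lt_le_trans _ _ (F b)); last exact/real_cdf_nd/ltW.
(* If [F] did not grow between [u] and [b], then [u] would be a point of [A] below its infimum. *)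
rewrite Fbx ltNge; apply/negP => Au.
by move: ub; rewrite ltNge => /negP; apply; apply: ge_inf => //; exists l.
Qed.

End Cdf.

(** * The law of the departure time *)

Section DepartureCdf.
Context {R : realType} {mu : R} (mu_gt0 : 0 < mu) (F : real_cdf R).

(** Integrates the lower and upper pointwise bounds used for [departure_cdf_bounds]. *)
Let integral_service_cdfD (c d r u : R) : 0 <= c -> 0 <= d ->
  (\int[arrival_law F]_a
     (c * service_cdf mu (r - Num.max a 0) + d * (a <= u)%R%:R)%:E)%E =
  (c * departure_cdf mu F r + d * F u)%:E.
Proof.
move=> c0 d0; under eq_integral do rewrite EFinD 2!EFinM.
have mu_le : measurable [set a : measurableTypeR R | a <= u].
  by rewrite -set_itvNyc; exact: measurable_itv.
have m1 : measurable_fun setT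
    (fun a : measurableTypeR R => (service_cdf mu (r - Num.max a 0))%:E).
  by apply/measurable_EFinP; exact: measurable_service_cdf.
have E : (fun a : measurableTypeR R => ((a <= u)%R%:R : R)%:E) =
    (fun a => (\1_[set a : measurableTypeR R | a <= u] a)%:E).
  by apply/funext => a; rewrite indicE mem_setE.
have m2 : measurable_fun setT
    (fun a : measurableTypeR R => ((a <= u)%R%:R : R)%:E).
  by rewrite E; apply/measurable_EFinP; exact: measurable_indic.
rewrite ge0_integralD//; first last.
- exact: measurable_funeM.
- by move=> a _; rewrite mule_ge0// lee_fin.
- exact: measurable_funeM.
- by move=> a _; rewrite mule_ge0// lee_fin service_cdf_ge0// ltW.
rewrite !ge0_integralZl//; try by move=> a _; rewrite lee_fin ?service_cdf_ge0// ltW.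
rewrite integral_service_cdf//.
rewrite E integral_indic// setIT EFinD !EFinM.
by congr (_ + _ * _)%E; exact: arrival_law_le.
Qed.

Lemma le_integral_arrival (f g : R -> R) :
  measurable_fun setT (f : measurableTypeR R -> R) ->
  measurable_fun setT (g : measurableTypeR R -> R) ->
  (forall a, 0 <= f a <= g a) ->
  (\int[arrival_law F]_a (f a)%:E <= \int[arrival_law F]_a (g a)%:E)%E.
Proof.
move=> mf mg fg; apply: ge0_le_integral => //.
- by move=> a _; rewrite lee_fin; case/andP: (fg a).
- exact/measurable_EFinP.
- exact/measurable_EFinP.
- by move=> a _; rewrite lee_fin; case/andP: (fg a).
Qed.

Let measurable_comb (c d r u : R) : measurable_fun setT
  (fun a : measurableTypeR R =>
     c * service_cdf mu (r - Num.max a 0) + d * (a <= u)%R%:R).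
Proof.
apply: measurable_funD; apply: measurable_funM => //.
  exact: measurable_service_cdf.
have -> : (fun a : measurableTypeR R => (a <= u)%R%:R) =
    (\1_[set a : measurableTypeR R | a <= u] : _ -> R).
  by apply/funext => a; rewrite indicE mem_setE.
by apply: measurable_indic; rewrite -set_itvNyc; exact: measurable_itv.
Qed.

(* [service_cdf] satisfies these bounds pointwise, with the indicators of
   [a <= r] and [a <= t] in place of [F r] and [F t]. *)
Lemma departure_cdf_bounds (r t : R) : 0 <= r -> r <= t ->
  expR (- mu * (t - r)) * departure_cdf mu F r + (1 - expR (- mu * (t - r))) * F r
  <= departure_cdf mu F t <=
  expR (- mu * (t - r)) * departure_cdf mu F r + (1 - expR (- mu * (t - r))) * F t.
Proof.
move=> r0 rt; set e := expR (- mu * (t - r)).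
have e0 : 0 <= e by exact: expR_ge0.
have e1 : 0 <= 1 - e.
  by rewrite subr_ge0 expR_decay_le1 ?subr_ge0// ltW.
(* For [a <= r] lack of memory makes both bounds equalities. For [r < a <= t] the value lies between
   0 and [1 - e], as the service has lasted at most [t - r]. For [a > t] every term is 0. *)
have key a :
    e * service_cdf mu (r - Num.max a 0) + (1 - e) * (a <= r)%R%:R
    <= service_cdf mu (t - Num.max a 0)
    <= e * service_cdf mu (r - Num.max a 0) + (1 - e) * (a <= t)%R%:R.
  have s0 x : x <= 0 -> service_cdf mu x = 0.
    by move=> x0; rewrite /service_cdf (max_idPr x0) mulr0 expR0 subrr.
  have s1 x : 0 <= x -> service_cdf mu x = 1 - expR (- mu * x).
    by move=> x0; rewrite /service_cdf (max_idPl x0).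
  have [ar|ra] := leP a r.
    have am : Num.max a 0 <= r by rewrite ge_max ar.
    rewrite (le_trans ar rt) /= !s1 ?subr_ge0//; last exact: le_trans am rt.
    have -> : expR (- mu * (t - Num.max a 0)) = e * expR (- mu * (r - Num.max a 0)).
      by rewrite -expRD; congr expR; ring.
    by apply/andP; split; lra.
  have a0 : 0 < a by exact: le_lt_trans ra.
  have ra0 : r - a <= 0 by rewrite subr_le0 ltW.
  rewrite (max_idPl (ltW a0)) (s0 _ ra0) mulr0n !mulr0 !add0r.
  have [at_|ta] := leP a t; last first.
    by rewrite mulr0n mulr0 s0 ?lexx// subr_le0 ltW.
  rewrite mulr1n mulr1 service_cdf_ge0 ?(ltW mu_gt0)//= s1 ?subr_ge0//.
  rewrite lerD2l lerN2 ler_expR.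
  by rewrite ler_nM2l ?oppr_lt0// lerD2l lerN2 ltW.
have s0 a : 0 <= service_cdf mu (t - Num.max a 0) by rewrite service_cdf_ge0// ltW.
rewrite -!lee_fin -!integral_service_cdfD// -(integral_service_cdf mu_gt0).
rewrite !le_integral_arrival//; try exact: measurable_comb;
  try exact: measurable_service_cdf.
- by move=> a; rewrite s0; case/andP: (key a).
- move=> a; case/andP: (key a) => -> _; rewrite andbT.
  by rewrite addr_ge0 ?mulr_ge0// service_cdf_ge0// ltW.
Qed.

Lemma departure_cdf_le0 (t : R) : t <= 0 -> departure_cdf mu F t = 0.
Proof.
move=> t0; apply/EFin_inj; rewrite -(integral_service_cdf mu_gt0).
apply: integral0_eq => a _; congr EFin; rewrite /service_cdf (_ : Num.max _ _ = 0).
  by rewrite mulr0 expR0 subrr.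
by apply/max_idPr; rewrite subr_le0 le_max t0 orbT.
Qed.

Lemma departure_cdf_ge0 (t : R) : 0 <= departure_cdf mu F t.
Proof.
rewrite -lee_fin -(integral_service_cdf mu_gt0); apply: integral_ge0 => a _.
by rewrite lee_fin service_cdf_ge0// ltW.
Qed.

Lemma departure_cdf_le (t : R) : 0 <= t ->
  departure_cdf mu F t <= (1 - expR (- mu * t)) * F t.
Proof.
move=> t0; have /andP[_] := departure_cdf_bounds _ _ (lexx 0) t0.
by rewrite (departure_cdf_le0 _ (lexx 0)) mulr0 add0r subr0.
Qed.

Lemma departure_cdf_le_cdf (t : R) : departure_cdf mu F t <= F t.
Proof.
have [t0|t0] := leP 0 t; last by rewrite departure_cdf_le0 ?real_cdf_ge0// ltW.
apply: le_trans (departure_cdf_le _ t0) _.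
by rewrite ler_piMl ?real_cdf_ge0// lerBlDr lerDl expR_ge0.
Qed.

(** The upper bound gives an increment of at most [1 - e], and [1 - e <= mu * (t - r)]. A negative
    [r] is replaced by 0, where [departure_cdf] also vanishes. *)
Lemma departure_cdf_lipschitz (r t : R) : r <= t ->
  departure_cdf mu F t - departure_cdf mu F r <= mu * (t - r).
Proof.
move=> rt; have m0 := ltW mu_gt0.
have H s : 0 <= s -> s <= t ->
    departure_cdf mu F t - departure_cdf mu F s <= mu * (t - s).
  move=> s0 st; have /andP[_] := departure_cdf_bounds _ _ s0 st.
  set e := expR _; have e1 : 1 - e <= mu * (t - s).
    by rewrite lerBlDr -lerBlDl; apply: le_trans (expR_ge1Dx _); lra.
  have e2 : 0 <= 1 - e.
    by rewrite subr_ge0 expR_decay_le1// subr_ge0.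
  have := departure_cdf_ge0 s; have := departure_cdf_ge0 t.
  by have := real_cdf_le1 F t; nra.
have [r0|r0] := leP 0 r; first exact: H.
have [t0|t0] := leP 0 t; last first.
  rewrite (departure_cdf_le0 _ (ltW r0)) (departure_cdf_le0 _ (ltW t0)) subrr.
  by rewrite mulr_ge0// subr_ge0.
have := H _ (lexx 0) t0.
rewrite (departure_cdf_le0 _ (ltW r0)) (departure_cdf_le0 _ (lexx 0)).
by move/le_trans; apply; rewrite ler_wpM2l// lerD2l lerN2 ltW.
Qed.

(** With positive probability a customer who came by [r] is still there at [r], so [departure_cdf]
    is below [F] at [r], and the lower bound pushes it up strictly. This makes the cost decrease
    along a gap. *)
Lemma departure_cdf_lt (r t : R) : 0 <= r -> r < t -> 0 < F r ->
  departure_cdf mu F r < departure_cdf mu F t.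
Proof.
move=> r0 rt Fr; have /andP[+ _] := departure_cdf_bounds _ _ r0 (ltW rt).
have := departure_cdf_le _ r0; have := expR_gt0 (- mu * r).
set e := expR (- mu * (t - r)) => er0 wr.
have e1 : 0 < 1 - e.
  by rewrite subr_gt0 /e -expR0 ltr_expR mulNr oppr_lt0 mulr_gt0 ?subr_gt0.
move=> wt; have wF : departure_cdf mu F r < F r by nra.
by nra.
Qed.

End DepartureCdf.

(** * Derivatives from quadratic error bounds, and a linear differential equation *)

Section Ode.
Context {R : realType}.

Lemma is_derive_quadratic (f : R -> R) (x l C d : R) : 0 < d -> 0 <= C ->
  (forall h, `|h| < d -> `|f (x + h) - f x - l * h| <= C * h ^+ 2) ->
  is_derive x 1 f l.
Proof.
move=> d0 C0 H.
have cf : h^-1 *: ((f \o shift x) (h *: 1) - f x) @[h --> (0 : R)^'] --> l.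
  apply/cvgrPdist_le => e e0; near=> h.
  have h0 : h != 0 by near: h; exact: nbhs_dnbhs_neq.
  have hd : `|h| < d by near: h; exact: dnbhs0_lt.
  have hC : `|h| <= e / (C + 1).
    (* Adding 1 to [C] keeps the divisor positive when [C] is 0. *)
    by near: h; apply: dnbhs0_le; rewrite divr_gt0// ltr_wpDl.
  rewrite /= /GRing.scale/= mulr1 [h + x]addrC.
  have -> : l - h^-1 * (f (x + h) - f x) =
      - (h^-1 * (f (x + h) - f x - l * h)) by field.
  rewrite normrN normrM normfV ler_pdivrMl ?normr_gt0//.
  apply: le_trans (H _ hd) _; rewrite -real_normK ?num_real// expr2 mulrA.
  rewrite [leRHS]mulrC ler_wpM2r//.
  have : (C + 1) * `|h| <= e by rewrite mulrC -ler_pdivlMr// ltr_wpDl.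
  by have := normr_ge0 h; nra.
split; first by apply/cvg_ex; exists l.
exact: cvg_lim.
Unshelve. all: end_near. Qed.

(** The integrating factor [expR (k * s)] turns [D] into a function with zero derivative on the open
    interval, and the mean value theorem compares its ends. *)
Lemma linear_ode_eq0 (k : R) (D : R -> R) :
  (forall t : R, 0 < t -> is_derive t 1 D (- k * D t)) -> continuous D -> D 0 = 0 ->
  forall t, 0 <= t -> D t = 0.
Proof.
move=> dD cD D0 t; rewrite le_eqVlt => /predU1P[<-//|t0].
pose h s := expR (k * s) * D s.
have ch : continuous h.
  move=> s; apply: (@continuousM _ _ (fun s => expR (k * s))); last exact: cD.
  apply: continuous_comp; last exact: continuous_expR.
  exact: mulrl_continuous.
have dh s : s \in `]0, t[ -> is_derive s 1 h (cst 0 s).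
  rewrite in_itv/= => /andP[s0 _].
  have dDs := dD s s0.
  apply: is_derive_eq.
  rewrite /GRing.scale/=; ring.
have [c _] := MVT t0 dh (continuous_subspaceT ch).
rewrite mul0r /h mulr0 expR0 mul1r D0 subr0 => /eqP.
by rewrite mulf_eq0 gt_eqF ?expR_gt0//= => /eqP.
Qed.

End Ode.

(** * The differential equation for the departure cdf *)

Section DepartureCdfDerivative.
Context {R : realType} {mu : R} (mu_gt0 : 0 < mu) (F : real_cdf R).

Lemma departure_cdf_nd (r t : R) :
  r <= t -> departure_cdf mu F r <= departure_cdf mu F t.
Proof.
move=> rt; have [r0|r0] := leP 0 r; last first.
  by rewrite (departure_cdf_le0 mu_gt0 _ _ (ltW r0)) departure_cdf_ge0.
have /andP[+ _] := departure_cdf_bounds mu_gt0 F _ _ r0 rt.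
have := departure_cdf_le_cdf mu_gt0 F r.
have : expR (- mu * (t - r)) <= 1.
  by rewrite expR_decay_le1 ?subr_ge0// ltW.
by nra.
Qed.

Lemma departure_cdf_continuous : continuous (departure_cdf mu F).
Proof.
move=> t; apply/cvgrPdist_le => e e0; near=> y.
have : `|t - y| <= e / mu.
  by near: y; apply: cvgr_dist_le; [exact: cvg_id|rewrite divr_gt0].
rewrite ler_pdivlMr// mulrC => ty; apply: le_trans ty.
have [yt|/ltW yt] := leP y t.
  by rewrite !ger0_norm ?subr_ge0 ?departure_cdf_nd// departure_cdf_lipschitz.
rewrite distrC [`|t - y|]distrC.
by rewrite !ger0_norm ?subr_ge0 ?departure_cdf_nd// departure_cdf_lipschitz.
Unshelve. all: end_near. Qed.

(** Both bounds of [departure_cdf_bounds] agree to first order in the step once [F] is Lipschitz. *)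
Lemma departure_cdf_is_derive (L t : R) : 0 <= L ->
  (forall r s : R, 0 <= r -> r <= s -> F s - F r <= L * (s - r)) ->
  0 < t -> is_derive t 1 (departure_cdf mu F) (mu * (F t - departure_cdf mu F t)).
Proof.
move=> L0 FL t0; have m0 := ltW mu_gt0.
(* The term [mu * L] pays for the variation of [F] over the step, [mu ^+ 2] for the second-order
   error of the exponential or for the variation of [departure_cdf]. The radius [t] keeps [t + h]
   positive. *)
apply: (@is_derive_quadratic _ _ _ _ (mu * L + mu ^+ 2) t) => //.
  by rewrite addr_ge0 ?mulr_ge0// sqr_ge0.
move=> h ht.
(* With [y = mu * x], the lower bound follows from exp(-y) <= 1/(1+y) <= 1 - y + y^2. *)
have ex (x : R) : 0 <= x ->
    mu * x - mu ^+ 2 * x ^+ 2 <= 1 - expR (- mu * x) <= mu * x.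
  move=> x0; have mx : 0 <= mu * x by rewrite mulr_ge0.
  have := expR_ge1Dx (- mu * x); rewrite mulNr => e1; apply/andP; split; last lra.
  have := expR_ge1Dx (mu * x); rewrite expRN => e2.
  have : (expR (mu * x))^-1 <= (1 + mu * x)^-1.
    by rewrite lef_pV2 ?posrE ?expR_gt0//; lra.
  have : (1 + mu * x)^-1 * (1 + mu * x) = 1 by rewrite mulVf//; lra.
  have : 0 < (1 + mu * x)^-1 by rewrite invr_gt0; lra.
  rewrite -exprMn; set v := (1 + mu * x)^-1; set y := mu * x => v0 v1 ev.
  suff : v <= 1 - y + y ^+ 2 by lra.
  have yv : y * v = 1 - v by lra.
  have yv0 : 0 <= y * v by rewrite mulr_ge0// ltW.
  have : y * (y * v) <= y * y by rewrite ler_wpM2l// ler_piMr//; lra.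
  by rewrite yv; lra.
have [h0|h0] := leP 0 h.
  have th : t <= t + h by rewrite lerDl.
  have := departure_cdf_bounds mu_gt0 F _ _ (ltW t0) th.
  have := FL _ _ (ltW t0) th.
  have := real_cdf_nd F _ _ th.
  have := departure_cdf_le_cdf mu_gt0 F t; have := departure_cdf_ge0 mu_gt0 F t.
  have := real_cdf_le1 F t.
  rewrite [t + h - t]addrAC subrr add0r; have := ex _ h0.
  move: (expR _) (departure_cdf mu F (t + h)) (departure_cdf mu F t) (F t) (F (t + h)).
  move=> e I1 I0 F0 F1 /andP[e1 e2] F01 I00 IF FF FL1 /andP[B1 B2].
  rewrite ler_norml; apply/andP; split.
    have : (mu * h - mu ^+ 2 * h ^+ 2) * (F0 - I0) <= (1 - e) * (F0 - I0).
      by rewrite ler_wpM2r// subr_ge0.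
    have : mu ^+ 2 * h ^+ 2 * (F0 - I0) <= mu ^+ 2 * h ^+ 2.
      by apply: ler_piMr; [rewrite mulr_ge0 ?sqr_ge0|lra].
    have : 0 <= mu * L * h ^+ 2 by rewrite mulr_ge0 ?sqr_ge0// mulr_ge0.
    by lra.
  have : (1 - e) * (F1 - I0) <= mu * h * (F1 - I0).
    by rewrite ler_wpM2r// subr_ge0; lra.
  have : mu * h * (F1 - F0) <= mu * h * (L * h).
    by rewrite ler_wpM2l// mulr_ge0.
  have : 0 <= mu ^+ 2 * h ^+ 2 by rewrite mulr_ge0 ?sqr_ge0.
  by lra.
(* For a negative step the bounds start at [t + h], so [departure_cdf] must also be compared at the
   two ends, by monotonicity or by its Lipschitz bound. *)
have [k0 tk] : 0 <= - h /\ 0 <= t + h.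
  by move: ht; rewrite ltr_norml; split; lra.
have th : t + h <= t by lra.
have := departure_cdf_bounds mu_gt0 F _ _ tk th.
have := FL _ _ tk th.
have := real_cdf_nd F _ _ th.
have := departure_cdf_le_cdf mu_gt0 F (t + h).
have := departure_cdf_ge0 mu_gt0 F (t + h).
have := departure_cdf_lipschitz mu_gt0 F _ _ th.
have := departure_cdf_nd _ _ th.
have := real_cdf_le1 F (t + h).
have -> : t - (t + h) = - h by ring.
have := ex _ k0.
move: (expR _) (departure_cdf mu F (t + h)) (departure_cdf mu F t) (F t) (F (t + h)).
move=> e I1 I0 F0 F1 /andP[e1 e2] F11 I10 II I1ge IF FF FL1 /andP[B1 B2].
rewrite ler_norml; apply/andP; split; last first.
  have : (mu * - h - mu ^+ 2 * (- h) ^+ 2) * (F1 - I1) <= (1 - e) * (F1 - I1).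
    by rewrite ler_wpM2r// subr_ge0.
  have : mu ^+ 2 * h ^+ 2 * (F1 - I1) <= mu ^+ 2 * h ^+ 2.
    by apply: ler_piMr; [rewrite mulr_ge0 ?sqr_ge0|lra].
  have : mu * - h * (F0 - F1) <= mu * - h * (L * - h).
    by rewrite ler_wpM2l// mulr_ge0.
  have : 0 <= mu * - h * (I0 - I1) by rewrite !mulr_ge0// subr_ge0.
  by lra.
have : (1 - e) * (F0 - I1) <= mu * - h * (F0 - I1).
  by rewrite ler_wpM2r// subr_ge0; lra.
have : mu * - h * (I0 - I1) <= mu * - h * (mu * - h).
  by rewrite ler_wpM2l// mulr_ge0.
have : 0 <= mu * L * h ^+ 2 by rewrite mulr_ge0 ?sqr_ge0// mulr_ge0.
by lra.
Qed.

End DepartureCdfDerivative.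

(** * Equilibrium *)

Section Equilibrium.
Context {R : realType} {alpha gamma mu : R}
  (alpha_gt0 : 0 < alpha) (gamma_gt0 : 0 < gamma) (mu_gt0 : 0 < mu).

Definition weight : R := gamma + alpha / mu.

(** The exponential rate of both arrivals and departures after time 0 in equilibrium. *)
Definition tail_rate : R := mu / (1 + alpha / (gamma * mu)).

Definition tail_mass : R := (1 + gamma * mu / alpha)^-1.

(** One formula for three ranges: the first term is 0 up to [- (gamma / alpha)], then linear, and
    frozen after 0; the second starts at 0 and carries the remaining mass [tail_mass]. *)
Definition equilibrium_cdf (t : R) : R :=
  Num.max 0 ((gamma + alpha * Num.min t 0) / weight) +
  tail_mass * (1 - expR (- tail_rate * Num.max t 0)).

Let a0 : alpha != 0. Proof. exact: lt0r_neq0. Qed.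
Let g0 : gamma != 0. Proof. exact: lt0r_neq0. Qed.
Let m0 : mu != 0. Proof. exact: lt0r_neq0. Qed.
Let K0 : 0 < gamma * mu + alpha. Proof. by rewrite addr_gt0// mulr_gt0. Qed.
Let Kn0 : gamma * mu + alpha != 0. Proof. exact: lt0r_neq0. Qed.
Let Kn0' : alpha + gamma * mu != 0. Proof. by rewrite addrC. Qed.

Let weightE : weight = (gamma * mu + alpha) / mu.
Proof. by rewrite /weight; field. Qed.

Let weight_gt0 : 0 < weight.
Proof. by rewrite weightE divr_gt0. Qed.

Let tail_rateE : tail_rate = gamma * mu ^+ 2 / (gamma * mu + alpha).
Proof. by rewrite /tail_rate; field; rewrite ?g0 ?m0 ?Kn0. Qed.

Let tail_massE : tail_mass = alpha / (gamma * mu + alpha).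
Proof. by rewrite /tail_mass; field; rewrite ?a0 ?Kn0 ?Kn0'. Qed.

Let tail_rate_gt0 : 0 < tail_rate.
Proof. by rewrite tail_rateE divr_gt0// mulr_gt0// exprn_gt0. Qed.

Let tail_mass_gt0 : 0 < tail_mass.
Proof. by rewrite tail_massE divr_gt0. Qed.

Let thresholdE (t : R) : (t <= - (gamma / alpha)) = (gamma + alpha * t <= 0).
Proof. by rewrite -mulNr ler_pdivlMr// mulrC -subr_le0 opprK addrC. Qed.

Let threshold_ltE (t : R) : (- (gamma / alpha) < t) = (0 < gamma + alpha * t).
Proof. by rewrite !ltNge thresholdE. Qed.

Let threshold_geE (t : R) : (- (gamma / alpha) <= t) = (0 <= gamma + alpha * t).
Proof. by rewrite -mulNr ler_pdivrMr// mulrC -subr_ge0 opprK addrC. Qed.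

(** The third hypothesis says that the difference from the claimed solution satisfies D' = -k D.
    Uniqueness uses it with [k = tail_rate], existence with [k = mu]. *)
Lemma departure_cdf_closed (F : real_cdf R) (k L : R) : 0 <= L ->
  (forall r s : R, 0 <= r -> r <= s -> F s - F r <= L * (s - r)) ->
  (forall t, 0 < t -> mu * (F t - departure_cdf mu F t) =
     tail_rate * expR (- tail_rate * t)
     - k * (departure_cdf mu F t - (1 - expR (- tail_rate * t)))) ->
  forall t, 0 <= t -> departure_cdf mu F t = 1 - expR (- tail_rate * t).
Proof.
move=> L0 FL FI t t0; apply/eqP; rewrite -subr_eq0; apply/eqP.
pose D s := departure_cdf mu F s - (1 - expR (- tail_rate * s)).
apply: (@linear_ode_eq0 _ k D) => //.
- move=> s s0; have dI := departure_cdf_is_derive mu_gt0 F L s L0 FL s0.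
  apply: is_derive_eq; rewrite FI// /D /GRing.scale/=; ring.
- move=> s; apply: continuousB; first exact: departure_cdf_continuous.
  apply: continuousB; first exact: cst_continuous.
  apply: continuous_comp; last exact: continuous_expR.
  exact: mulrl_continuous.
- by rewrite /D departure_cdf_le0// mulr0 expR0 subrr subr0.
Qed.

(** * Every equilibrium has the explicit cdf *)

Section Uniqueness.
Variables (G : real_cdf R) (c : R).
Hypothesis eqG : equilibrium_cost alpha gamma mu_gt0 G c.

Let I := departure_cdf mu G.

Let cost_support (t : R) : Defs.support G t ->
  alpha * Num.max (- t) 0 + weight * mid_cdf G t - alpha / mu * I t = c.
Proof. by case: eqG => H _ /H; rewrite costE => -[]. Qed.

Let cost_ge (t : R) :
  c <= alpha * Num.max (- t) 0 + weight * mid_cdf G t - alpha / mu * I t.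
Proof. by case: eqG => _ /(_ t); rewrite costE lee_fin. Qed.

(* An atom makes the cost jump up, while everything else in the cost is
   Lipschitz: arriving just before the atom would be strictly cheaper. *)
Lemma equilibrium_no_atom (b : R) : Defs.support G b -> mid_cdf G b = G b.
Proof.
move=> sb; have lG := left_lim_le G b.
suff : G b <= left_lim G b by rewrite /mid_cdf => ?; lra.
rewrite leNgt; apply/negP => jump.
pose p := G b - left_lim G b; have p0 : 0 < p by rewrite subr_gt0.
(* Leaving out the atom saves [weight * p / 2], while coming earlier by [h] costs at most
   [alpha * h] in each of the two Lipschitz terms, [weight * p / 4] in all. *)
pose h := weight * p / (8 * alpha).
have h0 : 0 < h by rewrite divr_gt0 ?mulr_gt0.
have hE : alpha * h = weight * p / 8 by rewrite /h; field.
have bh : b - h < b by lra.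
have cb := cost_support b sb; have := cost_ge (b - h).
have IL : alpha / mu * (I b - I (b - h)) <= alpha * h.
  have /(ler_wpM2l (ltW (divr_gt0 alpha_gt0 mu_gt0))) :=
    departure_cdf_lipschitz mu_gt0 G _ _ (ltW bh).
  by move/le_trans; apply; rewrite le_eqVlt; apply/orP; left; apply/eqP; field.
have ML : alpha * Num.max (- (b - h)) 0 <= alpha * Num.max (- b) 0 + alpha * h.
  rewrite -mulrDr ler_pM2l// ge_max; apply/andP; split.
    have : - b <= Num.max (- b) 0 by rewrite le_max lexx.
    by lra.
  have : 0 <= Num.max (- b) 0 by rewrite le_max lexx orbT.
  by lra.
have Ms : weight * mid_cdf G (b - h) <= weight * left_lim G b.
  by rewrite ler_pM2l//; apply: le_trans (left_lim_ge G _ _ bh); exact: mid_cdf_le.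
have Mb : weight * mid_cdf G b = weight * left_lim G b + weight * p / 2.
  by rewrite /mid_cdf /p; field.
have : 0 < weight * p by rewrite mulr_gt0.
by lra.
Qed.

(* If [x] were outside the support, the cost would have been strictly higher at
   the last support point before [x]. *)
Lemma equilibrium_support (x : R) : 0 < G x -> Defs.support G x.
Proof.
move=> Gx; have [b [bx sb Gb]] := support_level G x Gx.
move: bx; rewrite le_eqVlt => /predU1P[<-//|bx]; exfalso.
have cb := cost_support b sb; have := cost_ge x.
rewrite equilibrium_no_atom// Gb in cb.
have Mx : weight * mid_cdf G x <= weight * G x.
  by rewrite ler_pM2l//; exact: mid_cdf_le.
have am : 0 < alpha / mu by rewrite divr_gt0.
(* The strict drop of the cost comes from departures if [b >= 0], and from the shorter wait for the
   opening if [b < 0]. *)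
have [b0|b0] := leP 0 b.
  have Ibx : I b < I x by apply: departure_cdf_lt => //; rewrite Gb.
  have : alpha / mu * I b < alpha / mu * I x by rewrite ltr_pM2l.
  rewrite (max_idPr _) in cb; last by lra.
  by rewrite (max_idPr _); lra.
have : alpha / mu * I b <= alpha / mu * I x.
  by rewrite ler_pM2l//; apply: departure_cdf_nd => //; exact: ltW.
have : alpha * Num.max (- x) 0 < alpha * Num.max (- b) 0.
  by rewrite ltr_pM2l// gt_max !lt_max; apply/andP; split; lra.
by lra.
Qed.

Let cost_cdf_gt0 (x : R) : 0 < G x ->
  alpha * Num.max (- x) 0 + weight * G x - alpha / mu * I x = c.
Proof.
move=> /equilibrium_support sx.
by rewrite -[in LHS](equilibrium_no_atom x sx) cost_support.
Qed.

Lemma equilibrium_cost_eq : c = gamma.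
Proof.
have am : 0 < alpha / mu by rewrite divr_gt0.
have wE : weight = gamma + alpha / mu by [].
suff key e : 0 < e -> e <= 1 / 2 ->
    c <= gamma + 2 * weight * e /\ gamma - 2 * weight * e <= c.
  apply/eqP; rewrite eq_le; apply/andP; split; apply/ler_addgt0Pr => d d0.
  - pose e := Num.min (d / (2 * weight)) (1 / 2).
    have e0 : 0 < e by rewrite lt_min divr_gt0 ?mulr_gt0//; lra.
    have [|+ _] := key _ e0; first by rewrite ge_min lexx orbT.
    move/le_trans; apply; rewrite lerD2l mulrC -ler_pdivlMr ?mulr_gt0//.
    by rewrite ge_min lexx.
  - pose e := Num.min (d / (2 * weight)) (1 / 2).
    have e0 : 0 < e by rewrite lt_min divr_gt0 ?mulr_gt0//; lra.
    have [|_] := key _ e0; first by rewrite ge_min lexx orbT.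
    rewrite lerBlDr => /le_trans; apply.
    rewrite lerD2l mulrC -ler_pdivlMr ?mulr_gt0//.
    by rewrite ge_min lexx.
move=> e0 e1; have [T HT] := real_cdf_gt G _ e0.
(* From [r] on, [G] exceeds [1 - e]. After a further [s] the memory factor is exp(-1/e) <= e, so the
   departure cdf is at least (1-e)^2 >= 1 - 2e. *)
pose r := Num.max T 0 + 1; pose s := (mu * e)^-1.
have s0 : 0 < s by rewrite invr_gt0 mulr_gt0.
have r0 : 0 <= r by rewrite addr_ge0// le_max lexx orbT.
have Tr : T < r by rewrite ltr_pwDr// le_max lexx.
have rs : r <= r + s by rewrite lerDl ltW.
have Gr := HT _ Tr.
have Gs : 1 - e < G (r + s) by apply: HT; exact: lt_le_trans rs.
have := cost_cdf_gt0 (r + s) (lt_trans (_ : 0 < 1 - e) Gs).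
have -> : Num.max (- (r + s)) 0 = 0 by apply/max_idPr; lra.
have G1 := real_cdf_le1 G (r + s).
have IG := departure_cdf_le_cdf mu_gt0 G (r + s).
have /andP[+ _] := departure_cdf_bounds mu_gt0 G _ _ r0 rs.
have := departure_cdf_ge0 mu_gt0 G r.
have -> : r + s - r = s by lra.
set E := expR _ => I0 IE.
have Ee : E <= e.
  have := expR_ge1Dx (mu * s).
  have -> : mu * s = e^-1 by rewrite /s; field; rewrite m0 gt_eqF.
  rewrite /E mulNr expRN.
  have -> : mu * s = e^-1 by rewrite /s; field; rewrite m0 gt_eqF.
  move=> H; rewrite -[leRHS]invrK lef_pV2 ?posrE ?expR_gt0 ?invr_gt0//; lra.
have E0 : 0 < E by exact: expR_gt0.
have Ilow : 1 - 2 * e <= I (r + s).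
  have : 0 <= E * departure_cdf mu G r by rewrite mulr_ge0// ltW.
  by rewrite /I; nra.
move=> /(_ ltac:(lra)).
rewrite mulr0 add0r => <-; rewrite -/(I (r + s)) in IG *.
have : weight * (1 - e) <= weight * G (r + s) by rewrite ler_pM2l// ltW.
have : weight * G (r + s) <= weight by rewrite ler_piMr// ltW.
have : alpha / mu * (1 - 2 * e) <= alpha / mu * I (r + s) by rewrite ler_pM2l.
have : alpha / mu * I (r + s) <= alpha / mu by rewrite ler_piMr//; lra.
have : alpha / mu * e <= weight * e by rewrite ler_pM2r// wE lerDr ltW.
have : 0 < weight * e by rewrite mulr_gt0.
have : 0 < gamma * e by rewrite mulr_gt0.
by rewrite wE; split; lra.
Qed.

Lemma equilibrium_unique : G =1 equilibrium_cdf.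
Proof.
have cg := equilibrium_cost_eq.
have E0 : expR (- tail_rate * 0) = 1 by rewrite mulr0 expR0.
(* If nobody had come by [x], arriving then would cost only [- alpha * x], less than [gamma]. *)
have Gpos (x : R) : - (gamma / alpha) < x -> x <= 0 -> 0 < G x.
  move=> xl x0; rewrite lt_neqAle real_cdf_ge0 andbT eq_sym; apply/eqP => Gx.
  have := cost_ge x; have := mid_cdf_le G x; have := mid_cdf_ge0 G x.
  rewrite Gx => h1 h2; have -> : mid_cdf G x = 0 by lra.
  rewrite /I departure_cdf_le0// !mulr0 addr0 subr0 (max_idPl _); last by lra.
  by rewrite cg; move: xl; rewrite threshold_ltE; lra.
have Gneg (x : R) : 0 < G x -> x <= 0 -> weight * G x = gamma + alpha * x.
  move=> Gx x0; have := cost_cdf_gt0 x Gx.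
  rewrite cg /I departure_cdf_le0// mulr0 subr0 (max_idPl _); lra.
have G00 : 0 < G 0.
  by apply: Gpos => //; rewrite oppr_lt0 divr_gt0.
have G0pos (x : R) : 0 <= x -> weight * G x = gamma + alpha / mu * I x.
  move=> x0; have := cost_cdf_gt0 x.
  rewrite cg (max_idPr _); last by lra.
  move=> /(_ (lt_le_trans G00 (real_cdf_nd G _ _ x0))); lra.
move=> x; rewrite /equilibrium_cdf.
have [x0|x0] := leP x 0.
  rewrite E0 subrr mulr0 addr0.
  have [xl|xl] := ltP (- (gamma / alpha)) x.
    have Gx := Gpos x xl x0.
    rewrite -Gneg//.
    have -> : weight * G x / weight = G x by field; exact: lt0r_neq0.
    by rewrite (max_idPr _)// ltW.
  have gx : gamma + alpha * x <= 0 by rewrite -thresholdE.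
  rewrite (max_idPl _); last by rewrite pmulr_lle0// invr_gt0.
  apply/eqP; rewrite eq_le real_cdf_ge0 andbT leNgt; apply/negP => Gx.
  have := Gneg x Gx x0; have : 0 < weight * G x by rewrite mulr_gt0.
  by lra.
have GE (y : R) : 0 <= y -> G y = (gamma + alpha / mu * I y) / weight.
  by move=> y0; rewrite -G0pos//; field; exact: lt0r_neq0.
have IE : I x = 1 - expR (- tail_rate * x).
  apply: (@departure_cdf_closed G tail_rate (alpha / weight)); last exact: ltW.
  - by rewrite divr_ge0// ltW.
  (* For nonnegative times [G] is affine in the departure cdf, and inherits its Lipschitz bound. *)
  - move=> r s rr rs; rewrite !GE//; last exact: le_trans rs.
    have IL := departure_cdf_lipschitz mu_gt0 G _ _ rs.
    have -> : (gamma + alpha / mu * I s) / weight - (gamma + alpha / mu * I r) / weight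
        = alpha / weight / mu * (I s - I r) by field; rewrite m0 lt0r_neq0.
    by rewrite -mulrA ler_pM2l ?divr_gt0// mulrC ler_pdivrMr// [leRHS]mulrC.
  - move=> t t0; rewrite GE ?(ltW _)// -/I weightE tail_rateE; field.
    by rewrite m0 Kn0.
rewrite mulr0 addr0 GE ?(ltW _)// IE (max_idPr _); last by rewrite divr_ge0// ltW.
by rewrite weightE tail_massE; field; rewrite m0 Kn0.
Qed.

End Uniqueness.

(** * Construction of the explicit cdf *)

Section Existence.

Let F0 : R -> R := equilibrium_cdf.

Let equilibrium_cdf_left (t : R) : t <= - (gamma / alpha) -> F0 t = 0.
Proof.
move=> tl; have ga : 0 < gamma / alpha by rewrite divr_gt0.
rewrite /F0 /equilibrium_cdf (min_idPl _); last by lra.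
rewrite (max_idPr _ : Num.max t 0 = 0); last by lra.
rewrite mulr0 expR0 subrr mulr0 addr0; apply/max_idPl.
by rewrite pmulr_lle0 ?invr_gt0// -thresholdE.
Qed.

Let equilibrium_cdf_mid (t : R) : - (gamma / alpha) <= t -> t <= 0 ->
  F0 t = (gamma + alpha * t) / weight.
Proof.
move=> tl t0; rewrite /F0 /equilibrium_cdf (min_idPl t0) (max_idPr t0).
rewrite mulr0 expR0 subrr mulr0 addr0; apply/max_idPr.
by apply: divr_ge0; [rewrite -threshold_geE|exact: ltW].
Qed.

Let equilibrium_cdf_right (t : R) : 0 <= t ->
  F0 t = 1 - tail_mass * expR (- tail_rate * t).
Proof.
move=> t0; rewrite /F0 /equilibrium_cdf (min_idPr t0) (max_idPl t0) mulr0 addr0.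
rewrite (max_idPr _); last by rewrite divr_ge0// ltW.
by rewrite weightE tail_massE; field; rewrite m0 Kn0.
Qed.

Let equilibrium_cdf_nd : {homo F0 : r s / r <= s}.
Proof.
move=> r s rs; apply: lerD.
  rewrite ge_max le_max lexx/= le_max; apply/orP; right.
  rewrite ler_pM2r ?invr_gt0// lerD2l ler_pM2l//.
  by rewrite le_min !ge_min rs lexx !orbT.
rewrite ler_pM2l// lerD2l lerN2 ler_expR ler_nM2l ?oppr_lt0//.
by rewrite ge_max !le_max rs lexx !orbT.
Qed.

(** The slope of the linear piece plus the initial, hence largest, slope of the exponential
    piece. *)
Let lip := alpha / weight + tail_mass * tail_rate.

Let lip_ge0 : 0 <= lip.
Proof. by apply/ltW/addr_gt0; [exact: divr_gt0|exact: mulr_gt0]. Qed.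

Let equilibrium_cdf_lipschitz (r s : R) : r <= s -> F0 s - F0 r <= lip * (s - r).
Proof.
move=> rs; rewrite /F0 /equilibrium_cdf /lip [leRHS]mulrDl opprD addrACA; apply: lerD.
  rewrite lerBlDr ge_max; apply/andP; split.
    by rewrite addr_ge0 ?le_max ?lexx// mulr_ge0 ?subr_ge0// divr_ge0// ltW.
  have : (gamma + alpha * Num.min r 0) / weight <=
      Num.max 0 ((gamma + alpha * Num.min r 0) / weight) by rewrite le_max lexx orbT.
  have : alpha / weight * (Num.min s 0 - Num.min r 0) <= alpha / weight * (s - r).
    rewrite ler_pM2l ?divr_gt0//.
    by have [?|?] := leP s 0; have [?|?] := leP r 0; lra.
  have -> : (gamma + alpha * Num.min s 0) / weight =
      (gamma + alpha * Num.min r 0) / weight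
      + alpha / weight * (Num.min s 0 - Num.min r 0).
    by field; exact: lt0r_neq0.
  by lra.
rewrite -mulrBr -mulrA ler_pM2l//.
have rs0 : 0 <= Num.max s 0 - Num.max r 0 <= s - r.
  by have [?|?] := leP s 0; have [?|?] := leP r 0; apply/andP; split; lra.
have r0 : 0 <= Num.max r 0 by rewrite le_max lexx orbT.
move: (Num.max s 0) (Num.max r 0) rs0 r0 => b a /andP[ab ba] a_ge0.
have -> : expR (- tail_rate * b) =
    expR (- tail_rate * a) * expR (- (tail_rate * (b - a))).
  by rewrite -expRD; congr expR; ring.
have := expR_ge1Dx (- (tail_rate * (b - a))).
have : expR (- tail_rate * a) <= 1.
  by rewrite expR_decay_le1// ltW.
have := expR_gt0 (- tail_rate * a).
have : 0 <= tail_rate * (b - a) by rewrite mulr_ge0// ltW.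
have : tail_rate * (b - a) <= tail_rate * (s - r) by rewrite ler_pM2l.
move: (expR _) (expR _) => e d; nra.
Qed.

Lemma equilibrium_cdf_real_cdf : exists F : real_cdf R, F =1 equilibrium_cdf.
Proof.
have rc : right_continuous F0.
  move=> x; apply/cvgrPdist_le => e e0; near=> y.
  have xy : x <= y by near: y; exact: nbhs_right_ge.
  have yx : y <= x + e / (lip + 1).
    by near: y; apply: nbhs_right_le; rewrite ltrDl divr_gt0// ltr_wpDl.
  rewrite distrC ger0_norm ?subr_ge0 ?equilibrium_cdf_nd//.
  apply: le_trans (equilibrium_cdf_lipschitz _ _ xy) _.
  have : (lip + 1) * (y - x) <= e.
    by rewrite mulrC -ler_pdivlMr ?ltr_wpDl// lerBlDl.
  by lra.
have Ny : F0 @ -oo --> (0 : R).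
  apply/cvgrPdist_le => e e0; near=> t.
  rewrite equilibrium_cdf_left ?subrr ?normr0 ?ltW//.
  by near: t; apply: nbhs_ninfty_lt; exact: num_real.
have y : F0 @ +oo --> (1 : R).
  apply/cvgrPdist_le => e e0; near=> t.
  (* Then [tail_rate * t >= e^-1], and exp(-y) <= 1/y bounds the tail by [e]. *)
  have te : (tail_rate * e)^-1 <= t by near: t; apply: nbhs_pinfty_ge; exact: num_real.
  have t0 : 0 <= t by apply: le_trans te; rewrite invr_ge0 mulr_ge0// ltW.
  rewrite equilibrium_cdf_right// opprB addrC subrK.
  rewrite ger0_norm; last by rewrite mulr_ge0 ?expR_ge0// ltW.
  have tm1 : tail_mass <= 1.
    by rewrite tail_massE ler_pdivrMr// mul1r lerDr mulr_ge0// ltW.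
  apply: le_trans (_ : expR (- tail_rate * t) <= _).
    by rewrite ler_piMl ?expR_ge0.
  rewrite mulNr expRN -[leRHS]invrK lef_pV2 ?posrE ?expR_gt0 ?invr_gt0//.
  apply: le_trans (_ : tail_rate * t <= _); last by apply: le_trans (expR_ge1Dx _); lra.
  by rewrite -ler_pdivrMl// -invfM.
pose C := isCumulative.Build R _ R F0 equilibrium_cdf_nd rc.
pose B := isCumulativeBounded.Build R 0 1 F0 Ny y.
pose F : real_cdf R := HB.pack F0 C B.
by exists F.
Unshelve. all: end_near. Qed.

(** * Cost, support and density of the explicit cdf *)

Section Properties.
Variable F : real_cdf R.
Hypothesis FE : F =1 equilibrium_cdf.

(** The Lipschitz bound excludes atoms. *)
Let mid_cdfE (t : R) : mid_cdf F t = F t.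
Proof.
suff : F t <= left_lim F t by have := left_lim_le F t; rewrite /mid_cdf; lra.
apply/ler_addgt0Pr => e e0; pose h := e / (lip + 1).
have l1 : 0 < lip + 1 by rewrite ltr_wpDl.
have h0 : 0 < h by rewrite divr_gt0.
have th : t - h < t by lra.
have := left_lim_ge F _ _ th; have := equilibrium_cdf_lipschitz _ _ (ltW th).
rewrite /F0 -!FE; have : (lip + 1) * h = e by rewrite /h mulrC divfK// lt0r_neq0.
have -> : t - (t - h) = h by ring.
by lra.
Qed.

Let departure_cdfE (t : R) : 0 <= t -> departure_cdf mu F t = 1 - expR (- tail_rate * t).
Proof.
move: t; apply: (@departure_cdf_closed F mu lip) => //.
  by move=> r s _ rs; rewrite !FE; exact: equilibrium_cdf_lipschitz.
move=> t t0; rewrite FE -/(F0 t) equilibrium_cdf_right; last exact: ltW.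
(* The identity is [mu * (1 - tail_mass) = tail_rate]; only the coefficient is unfolded, so that the
   exponentials on both sides still match. *)
by rewrite tail_massE [X in _ = X * _ - _]tail_rateE; field.
Qed.

(** Before [- (gamma / alpha)] nobody is ahead and only the wait until 0 is paid; afterwards the
    explicit values of [F] and of the departure cdf balance to [gamma]. *)
Lemma equilibrium_cdf_cost (t : R) :
  cost alpha gamma mu_gt0 F t = (Num.max gamma (- (alpha * t)))%:E.
Proof.
rewrite costE -/weight mid_cdfE FE -/(F0 t); congr EFin.
have [tl|tl] := leP t (- (gamma / alpha)).
  have ga : 0 < gamma / alpha by rewrite divr_gt0.
  have at_ : gamma <= - (alpha * t) by move: tl; rewrite thresholdE; lra.
  rewrite equilibrium_cdf_left// (max_idPr at_) (max_idPl _); last by lra.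
  by rewrite departure_cdf_le0//; lra.
have at_ : - (alpha * t) <= gamma by move: tl; rewrite threshold_ltE; lra.
rewrite (max_idPl at_); have [t0|t0] := leP t 0.
  rewrite equilibrium_cdf_mid//; last exact: ltW.
  rewrite (max_idPl _) ?oppr_ge0// departure_cdf_le0//.
  by field; rewrite m0 lt0r_neq0.
rewrite equilibrium_cdf_right; last exact: ltW.
rewrite (max_idPr _); last by lra.
rewrite departure_cdfE; last exact: ltW.
by rewrite weightE tail_massE; field; rewrite m0 Kn0.
Qed.

Lemma equilibrium_cdf_support (t : R) :
  Defs.support F t <-> - (gamma / alpha) <= t.
Proof.
split=> [/support_cdfP Flt|tl]; last (apply/support_cdfP => u v ut tv).
  rewrite leNgt; apply/negP => tl.
  have := Flt (t - 1) (- (gamma / alpha)).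
  rewrite !FE -/(F0 _) -/(F0 (- (gamma / alpha))) !equilibrium_cdf_left//; last by lra.
  by rewrite ltxx => H; suff : false by []; apply: H; lra.
rewrite !FE -/(F0 u) -/(F0 v).
apply: (@le_lt_trans _ _ (F0 t)); first by apply: equilibrium_cdf_nd; exact: ltW.
have [t0|t0] := leP 0 t.
  rewrite !equilibrium_cdf_right//; last by lra.
  by rewrite ltrD2l ltrN2 ltr_pM2l// ltr_expR ltr_nM2l// oppr_lt0.
(* Cutting [v] at 0 keeps both points on the linear piece. *)
have tv' : t < Num.min v 0 by rewrite lt_min tv t0.
apply: (@lt_le_trans _ _ (F0 (Num.min v 0))); last first.
  by apply: equilibrium_cdf_nd; rewrite ge_min lexx.
rewrite !equilibrium_cdf_mid ?ge_min ?lexx ?orbT//; try lra.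
by rewrite ltr_pM2r ?invr_gt0// ltrD2l ltr_pM2l.
Qed.

Lemma equilibrium_cdf_equilibrium : equilibrium_cost alpha gamma mu_gt0 F gamma.
Proof.
split=> t; rewrite equilibrium_cdf_cost; last by rewrite lee_fin le_max lexx.
move=> /equilibrium_cdf_support tl; congr EFin; apply/max_idPl.
by move: tl; rewrite threshold_geE; lra.
Qed.

Lemma equilibrium_cdf_locally_finite :
  locally_finite_union_of_intervals (Defs.support F).
Proof.
(* One interval is enough; it is empty when [b] lies left of the support or of [a]. *)
move=> a b; exists [:: (Num.max a (- (gamma / alpha)), b)].
apply/seteqP; split=> [t [/equilibrium_cdf_support tl]|t [J]]; rewrite /= ?in_itv/=.
  move=> /andP[ta tb]; eexists; first by rewrite inE; exact: eqxx.
  by rewrite in_itv/= ge_max ta tl tb.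
rewrite inE => /eqP -> /=; rewrite ge_max -andbA => /and3P[ta tl tb].
by split; [exact/equilibrium_cdf_support|rewrite ta tb].
Qed.

Lemma equilibrium_density_ge0 (t : R) : 0 <= equilibrium_density alpha gamma mu t.
Proof.
rewrite /equilibrium_density; case: ifP => _; last case: ifP => _ //.
  by rewrite divr_ge0// ltW.
rewrite mulr_ge0 ?expR_ge0// divr_ge0 ?mulr_ge0 ?addr_ge0// ?divr_ge0 ?mulr_ge0//;
  exact: ltW.
Qed.

(** A uniform piece plus a scaled exponential density reduce measurability and integration to known
    cases. The second indicator leaves the point 0 to the first piece. *)
Let densityE (t : R) : equilibrium_density alpha gamma mu t =
  alpha / weight * \1_`[- (gamma / alpha), 0] t
  + tail_mass * (exponential_pdf tail_rate t * \1_`]0, +oo[ t).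
Proof.
rewrite /equilibrium_density !indicE !mem_setE !in_itv/= andbT.
have [/andP[tl t0]|] := boolP (_ <= t <= 0).
  by rewrite ltNge t0/= mulr1 !mulr0 addr0.
move=> _; rewrite mulr0 add0r; have [t0|t0] := ltP 0 t; last by rewrite !mulr0.
rewrite mulr1 exponential_pdfE; last exact: ltW.
rewrite /tail_rate /tail_mass; field.
by rewrite ?a0 ?g0 ?m0 ?Kn0 ?Kn0'.
Qed.

Lemma measurable_equilibrium_density :
  measurable_fun setT (equilibrium_density alpha gamma mu).
Proof.
rewrite (_ : equilibrium_density _ _ _ = fun t => alpha / weight *
    \1_`[- (gamma / alpha), 0] t
    + tail_mass * (exponential_pdf tail_rate t * \1_`]0, +oo[ t)); last first.
  by apply/funext => t; exact: densityE.
apply: measurable_funD; apply: measurable_funM => //.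
apply: measurable_funM; first exact: measurable_exponential_pdf.
by apply: measurable_indic; exact: measurable_itv.
Qed.

Lemma equilibrium_cdf_density : has_density F (equilibrium_density alpha gamma mu).
Proof.
split; [exact: measurable_equilibrium_density|exact: equilibrium_density_ge0|].
have mf D : measurable_fun D (EFin \o equilibrium_density alpha gamma mu).
  by apply/measurable_funTS/measurable_EFinP; exact: measurable_equilibrium_density.
have Hneg t : t <= 0 -> (F t)%:E =
    (\int[lebesgue_measure]_(x in `]-oo, t])
       (equilibrium_density alpha gamma mu x)%:E)%E.
  move=> t0.
  rewrite (eq_integral (fun x : measurableTypeR R => (alpha / weight)%:E *
      (\1_`[- (gamma / alpha), 0] x)%:E)%E); last first.
    move=> x; rewrite inE/= in_itv/= => xt; rewrite densityE EFinD EFinM.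
    rewrite [X in (_ + (_ * (_ * X))%:E)%E]indicE memNset/=; last first.
      by rewrite in_itv/= andbT; apply/negP; rewrite -leNgt (le_trans xt).
    by rewrite !mulr0 adde0.
  rewrite ge0_integralZl//; first last.
  - by rewrite lee_fin divr_ge0// ltW.
  - by apply/measurable_funTS/measurable_EFinP; apply: measurable_indic.
  rewrite integral_indic//.
  rewrite (_ : _ `&` _ = `[- (gamma / alpha), t]%classic); last first.
    apply/seteqP; split => x /=; rewrite !in_itv/=.
      by move=> [/andP[-> _] ->].
    by move=> /andP[-> xt]; rewrite (le_trans xt).
  rewrite FE -/(F0 t) [X in (_ * X)%E]lebesgue_measure_itv/= lte_fin.
  have [tl|tl] := ltP (- (gamma / alpha)) t.
    rewrite equilibrium_cdf_mid//; last exact: ltW.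
    rewrite -EFinD -EFinM; congr EFin; field.
    by rewrite a0 lt0r_neq0.
  by rewrite equilibrium_cdf_left// mule0.
move=> t; have [/Hneg//|t0] := leP t 0.
have -> : `]-oo, t]%classic = `]-oo, 0]%classic `|` `]0, t]%classic.
  apply/seteqP; split => x /=; rewrite !in_itv/=.
    by move=> xt; have [x0|x0] := leP x 0; [left|right].
  by case=> [x0|/andP[]//]; exact: le_trans x0 (ltW t0).
rewrite ge0_integral_setU//; first last.
- apply/disj_setPS => x [] /=; rewrite !in_itv/= => x0 /andP[].
  by rewrite ltNge x0.
- by move=> x _; rewrite lee_fin equilibrium_density_ge0.
- exact: mf.
rewrite -[X in _ = (X + _)%E](Hneg 0 (lexx 0)).
rewrite (eq_integral (fun x : measurableTypeR R =>
    tail_mass%:E * (exponential_pdf tail_rate x)%:E)%E);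
    last first.
  move=> x; rewrite inE/= in_itv/= => /andP[x0 xt]; rewrite densityE -EFinM.
  rewrite indicE memNset/=; last first.
    by rewrite in_itv/= => /andP[_]; rewrite leNgt x0.
  by rewrite mulr0 add0r indicE mem_set/= ?mulr1// in_itv/= x0.
rewrite ge0_integralZl//; first last.
- by rewrite lee_fin ltW.
- by move=> x _; rewrite lee_fin exponential_pdf_ge0// ltW.
- by apply/measurable_funTS/measurable_EFinP; exact: measurable_exponential_pdf.
(* The exponential law is used here with rate [tail_rate], not as a service time; the half-line up
   to 0 has mass zero. *)
have E : service_law tail_rate_gt0 `]0, t]%classic =
    (1 - expR (- tail_rate * t))%:E.
  have := service_law_le tail_rate_gt0 t.
  rewrite /service_cdf (max_idPl (ltW t0)) => <-.
  have -> : [set s | s <= t] = [set s | s <= 0] `|` `]0, t]%classic.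
    apply/seteqP; split => x /=; rewrite !in_itv/=.
      by move=> xt; have [x0|x0] := leP x 0; [left|right].
    by case=> [x0|/andP[]//]; exact: le_trans x0 (ltW t0).
  rewrite measureU//; first last.
  - apply/seteqP; split => // x [] /= x0; rewrite in_itv/= => /andP[].
    by rewrite ltNge x0.
  - by rewrite -set_itvNyc; exact: measurable_itv.
  rewrite [X in (X + _)%E](_ : _ = 0%E) ?add0e//.
  apply: etrans (service_law_le tail_rate_gt0 0) _.
  by rewrite /service_cdf maxxx mulr0 expR0 subrr.
rewrite [X in (_ + _ * X)%E]E.
rewrite !FE -/(F0 t) -/(F0 0) -EFinM -EFinD !equilibrium_cdf_right//; last exact: ltW.
by rewrite mulr0 expR0; congr EFin; ring.
Qed.

End Properties.

End Existence.

End Equilibrium.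

Theorem theorem2p1 (R : realType) (alpha gamma mu : R)
    (alpha_gt0 : 0 < alpha) (gamma_gt0 : 0 < gamma) (mu_gt0 : 0 < mu) :
  exists F : real_cdf R,
    [/\ has_density F (equilibrium_density alpha gamma mu),
        symmetric_equilibrium alpha gamma mu_gt0 F,
        (forall c : R, equilibrium_cost alpha gamma mu_gt0 F c <-> c = gamma) &
        (forall G : real_cdf R,
           symmetric_equilibrium alpha gamma mu_gt0 G -> G =1 F)].
Proof.
have [F FE] := equilibrium_cdf_real_cdf alpha_gt0 gamma_gt0 mu_gt0.
have eqF := equilibrium_cdf_equilibrium alpha_gt0 gamma_gt0 mu_gt0 F FE.
exists F; split.
- exact: equilibrium_cdf_density.
- split; last by exists gamma.
  exact: (equilibrium_cdf_locally_finite alpha_gt0 gamma_gt0 mu_gt0).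
- move=> c; split=> [eqc|->//].
  exact: (equilibrium_cost_eq alpha_gt0 gamma_gt0 mu_gt0 F).
- move=> G [_ [c eqG]] x; rewrite FE.
  exact: equilibrium_unique eqG x.
Qed.
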